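(* Let $\mathcal{A}=\langle A;\Xi\rangle$ be an algebra and $f:A\to A$. 1) The following are equivalent: (i) $f$ is $\mathcal{A}$-congruence preserving; (ii) for every subset $L\subseteq A$, $f^{-1}(L)\in\mathcal{B}^\infty_{\mathcal{A}}(L)$. 2) The following are equivalent: (i') $f$ preserves the $\mathcal{A}$-congruences which have finite index; (ii') for every $\mathcal{A}$-recognizable subset $L\subseteq A$, $f^{-1}(L)$ is in the (finite) Boolean algebra $\mathcal{B}_{\mathcal{A}}(L)$.
   Context: An algebra $\langle A;\Xi\rangle$: nonempty set $A$ with operations $\xi:A^{ar(\xi)}\to A$. An $\mathcal{A}$-congruence is an equivalence relation $\sim$ with $x_1\sim y_1,\ldots,x_m\sim y_m\Rightarrow\xi(\vec x)\sim\xi(\vec y)$ for each $m$-ary $\xi\in\Xi$; finite index means finitely many classes; $f$ preserves $\sim$ if $x\sim y\Rightarrow f(x)\sim f(y)$, and is congruence preserving if it preserves all congruences. Frozen functions: for $\xi$ of arity $m\ge1$, $1\le i\le m$, constants $c_j$, the map $x\mapsto\xi(c_1,\ldots,c_{i-1},x,c_{i+1},\ldots,c_m)$. $\mathrm{DUO}(\mathcal{A})$: identity and all finite compositions of frozen functions. $L$ is $\mathcal{A}$-recognizable if there is a finite algebra $\mathcal{M}$ of the same signature and a surjective morphism $\varphi:\mathcal{A}\to\mathcal{M}$ with $L=\varphi^{-1}(\varphi(L))$. $\mathcal{B}_{\mathcal{A}}(L)$ is the smallest family of subsets of $A$ containing $L$, closed under binary union, binary intersection and complementation, and under $\gamma^{-1}$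 for all $\gamma\in\mathrm{DUO}(\mathcal{A})$; $\mathcal{B}^\infty_{\mathcal{A}}(L)$ is defined likewise with closure under arbitrary nonempty unions and intersections and complementation. *)

(* Defs.v *)
From Stdlib Require Import RelationClasses.
From mathcomp Require Import all_boot.
From mathcomp Require Import boolp classical_sets functions cardinality.

Set Implicit Arguments.
Unset Strict Implicit.
Unset Printing Implicit Defensive.

Local Open Scope classical_set_scope.

Record signature := Signature { symbol : Type; ar : symbol -> nat }.

Record algebra (S : signature) := Algebra {
  carrier :> Type;
  op : forall xi : symbol S, ('I_(ar xi) -> carrier) -> carrier;
  carrier_inhabited : inhabited carrier }.

Section Congruences.
Variables (S : signature) (A : algebra S).

Definition congruence (r : A -> A -> Prop) : Prop :=
  Equivalence r /\
  forall (xi : symbol S) (x y : 'I_(ar xi) -> A),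
    (forall i, r (x i) (y i)) -> r (op x) (op y).

Definition finite_index (r : A -> A -> Prop) : Prop :=
  finite_set (range (fun x : A => [set y | r x y])).

Definition preserves (f : A -> A) (r : A -> A -> Prop) : Prop :=
  forall x y, r x y -> r (f x) (f y).

Definition congruence_preserving (f : A -> A) : Prop :=
  forall r, congruence r -> preserves f r.

Definition finite_index_congruence_preserving (f : A -> A) : Prop :=
  forall r, congruence r -> finite_index r -> preserves f r.

(* The value [c i] is irrelevant. An operation of arity 0 has no frozen
   function, since ['I_0] is empty. *)
Definition frozen (xi : symbol S) (i : 'I_(ar xi)) (c : 'I_(ar xi) -> A)
    (x : A) : A :=
  op (fun j => if j == i then x else c j).

Inductive DUO : (A -> A) -> Prop :=
| DUO_id : DUO idfun
| DUO_comp (xi : symbol S) (i : 'I_(ar xi)) (c : 'I_(ar xi) -> A)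
    (g : A -> A) : DUO g -> DUO (frozen i c \o g).

Definition DUO_preimage_closed (F : set (set A)) : Prop :=
  forall (g : A -> A) (X : set A), DUO g -> F X -> F (g @^-1` X).

Definition boolean_closed (F : set (set A)) : Prop :=
  [/\ forall X Y, F X -> F Y -> F (X `|` Y),
      forall X Y, F X -> F Y -> F (X `&` Y) &
      forall X, F X -> F (~` X)].

Definition complete_boolean_closed (F : set (set A)) : Prop :=
  [/\ forall G : set (set A), G !=set0 -> G `<=` F -> F (\bigcup_(X in G) X),
      forall G : set (set A), G !=set0 -> G `<=` F -> F (\bigcap_(X in G) X) &
      forall X, F X -> F (~` X)].

Definition BA (L : set A) : set (set A) :=
  smallest (fun F => boolean_closed F /\ DUO_preimage_closed F) [set L].

Definition BAinf (L : set A) : set (set A) :=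
  smallest (fun F => complete_boolean_closed F /\ DUO_preimage_closed F)
    [set L].

End Congruences.

Definition morphism (S : signature) (A M : algebra S) (phi : A -> M) : Prop :=
  forall (xi : symbol S) (x : 'I_(ar xi) -> A), phi (op x) = op (phi \o x).

Definition recognizable (S : signature) (A : algebra S) (L : set A) : Prop :=
  exists (M : algebra S) (phi : A -> M),
    [/\ finite_set [set: M], morphism phi, range phi = [set: M] &
        L = phi @^-1` (phi @` L)].

(* Main.v *)
(* Both parts rest on the syntactic congruence of [L]: the class of [x] is the
   intersection, over all DUO functions [g], of [g @^-1` L] or its complement,
   whichever contains [x].  Hence every union of classes belongs to [BAinf L],
   and if [f] preserves this congruence then [f @^-1` L] is such a union.
   Conversely, the sets saturated for a congruence [r] form a complete Boolean
   algebra closed under DUO preimages; taking for [L] the class of [f x] shows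
   that [f] preserves [r].  When [r] has finite index there are only finitely
   many saturated sets, so for recognizable [L] all unions and intersections
   above are finite. *)

Require Import Defs.
From Stdlib Require Import RelationClasses.
From mathcomp Require Import all_boot.
From mathcomp Require Import boolp classical_sets functions cardinality.

Set Implicit Arguments.
Unset Strict Implicit.
Unset Printing Implicit Defensive.

Local Open Scope classical_set_scope.

(** Once [D] is listed by [s], each subset is the image under [h] of an element of the finite type
    [{set seq_sub s}]. *)
Lemma finite_set_subsets (T : Type) (D : set T) :
  finite_set D -> finite_set [set X : set T | X `<=` D].
Proof.
move=> /(@finite_seqP {classic T})[s ->].
pose h (B : {set seq_sub s}) : set T := [set x | exists2 u, u \in B & val u = x].
apply: (@sub_finite_set _ _ (h @` setT)); last exact/finite_image/finite_finset.
move=> X Xs; exists [set u : seq_sub s | `[< X (val u) >]]%SET => //.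
apply/seteqP; split=> [x [u]|x Xx]; first by rewrite inE => /asboolP ? <-.
by exists (SeqSub (Xs x Xx)) => //; rewrite inE; apply/asboolP.
Qed.

(** * Unary contexts, the syntactic congruence and saturated sets *)

Section Congruences.
Variables (S : signature) (A : algebra S).
Implicit Types (r : A -> A -> Prop) (L X : set A) (F : set (set A)).

(** [DUO_comp] adds frozen functions on the outside; compatibility of [syntactic] with the
    operations needs them on the inside. *)
Lemma DUO_frozen_comp (g : A -> A) (xi : symbol S) (i : 'I_(ar xi))
    (c : 'I_(ar xi) -> A) :
  DUO g -> DUO (g \o frozen i c).
Proof.
elim=> [|zeta j d h _ IH]; first exact: (DUO_comp i c (@DUO_id S A)).
exact: (DUO_comp j d IH).
Qed.

Lemma preserves_DUO r (g : A -> A) : congruence r -> DUO g -> preserves g r.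
Proof.
move=> [[r_refl _ _] r_op]; elim=> [//|xi i c h _ IH] x y /IH rxy.
by apply: r_op => j; case: ifP.
Qed.

Lemma frozen_congruence r :
    Equivalence r ->
    (forall (xi : symbol S) (i : 'I_(ar xi)) (c : 'I_(ar xi) -> A),
      preserves (frozen i c) r) ->
  congruence r.
Proof.
move=> rE r_frozen; split=> // xi x y rxy.
have [r_refl _ r_trans] := rE.
(* Change the arguments one at a time, from left to right. *)
pose h k (j : 'I_(ar xi)) := if (j < k)%N then y j else x j.
have rh k : r (op x) (op (h k)).
  elim: k => [|k IH]; first exact: r_refl.
  apply: r_trans IH _; have [ltk|gek] := ltnP k (ar xi); last first.
    suff -> : h k.+1 = h k by exact: r_refl.
    apply/funext => j; rewrite /h ltnS.
    by have ltj := leq_trans (ltn_ord j) gek; rewrite ltj ltnW.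
  (* [h k] and [h k.+1] can differ only at index [k], so both results are values of one frozen
     function with constants [h k]. *)
  have -> : op (h k) = frozen (Ordinal ltk) (h k) (x (Ordinal ltk)).
    congr op; apply/funext => j; case: eqP => // ->.
    by rewrite /h /= ltnn.
  have -> : op (h k.+1) = frozen (Ordinal ltk) (h k) (y (Ordinal ltk)).
    congr op; apply/funext => j; case: eqP => [->|/eqP neq].
      by rewrite /h /= ltnSn.
    by rewrite /h ltnS leq_eqVlt -[k]/(val (Ordinal ltk)) val_eqE (negPf neq).
  exact: r_frozen.
have -> : y = h (ar xi) by apply/funext => j; rewrite /h ltn_ord.
exact: rh.
Qed.

(** A Myhill-Nerode equivalence with DUO functions as contexts: the coarsest congruence for which
    [L] is a union of classes. *)
Definition syntactic L (x y : A) : Prop := forall g, DUO g -> L (g x) <-> L (g y).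

Lemma syntactic_congruence L : congruence (syntactic L).
Proof.
apply: frozen_congruence.
  split=> [x g _|x y xy g Dg|x y z xy yz g Dg] //; first by have [] := xy g Dg.
  by apply: iff_trans (xy g Dg) (yz g Dg).
by move=> xi i c x y xy g Dg; apply: xy (DUO_frozen_comp i c Dg).
Qed.

Definition saturated r : set (set A) :=
  [set X | forall x y, r x y -> X x -> X y].

Lemma saturated_class r x : Equivalence r -> saturated r [set y | r x y].
Proof. by move=> [_ _ r_trans] y z ryz rxy; apply: r_trans ryz. Qed.

Lemma saturated_complete_boolean_closed r :
  Equivalence r -> complete_boolean_closed (saturated r).
Proof.
move=> [_ r_sym _]; split=> [G _ GF x y rxy [X GX Xx]|G _ GF x y rxy GX X /[dup]|].
- by exists X => //; apply: GF rxy Xx.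
- by move=> /GF FX /GX; apply: FX.
- by move=> X FX x y /r_sym ryx nXx /(FX _ _ ryx).
Qed.

Lemma saturated_DUO_preimage_closed r :
  congruence r -> DUO_preimage_closed (saturated r).
Proof.
move=> rC g X Dg FX x y rxy; exact: FX (preserves_DUO rC Dg rxy).
Qed.

(** A saturated set is the union of the classes it contains, hence is determined by a subset of the
    finite set of classes. *)
Lemma finite_saturated r :
  Equivalence r -> finite_index r -> finite_set (saturated r).
Proof.
move=> [r_refl _ _] /finite_set_subsets.
move=> /(finite_image (fun G => \bigcup_(X in G) X)); apply: sub_finite_set.
move=> X FX; exists [set C | range (fun x => [set y | r x y]) C /\ C `<=` X].
  by move=> C [].
apply/seteqP; split=> [x [C [_ CX] /CX]//|x Xx].
exists [set y | r x y]; last exact: r_refl.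
by split=> [|y rxy]; [exists x | exact: FX rxy Xx].
Qed.

(** * Finite versus complete Boolean closure *)

Lemma complete_boolean_closedW F : complete_boolean_closed F -> boolean_closed F.
Proof.
move=> [Fcup Fcap FC]; split=> // X Y FX FY.
- rewrite -[X](bigcup_set1 id) -[Y](bigcup_set1 id) -bigcup_setU.
  by apply: Fcup => [|Z [|] ->//]; exists X; left.
- rewrite -[X](bigcap_set1 id) -[Y](bigcap_set1 id) -bigcap_setU.
  by apply: Fcap => [|Z [|] ->//]; exists X; left.
Qed.

Lemma finite_complete_boolean_closed F :
  finite_set F -> boolean_closed F -> complete_boolean_closed F.
Proof.
move=> finF [FU _ FC].
have Fcup G : G !=set0 -> G `<=` F -> F (\bigcup_(X in G) X).
  move=> [X GX] GF.
  have /(@finite_seqP {classic (set A)})[s Gs] := sub_finite_set GF finF.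
  (* The member [X] excludes the empty list, so the induction really starts at singletons. *)
  rewrite {}Gs in GX GF *; elim: s => [//|Y [|Z s] IH] in X GX GF *.
    by rewrite set_cons1 bigcup_set1; apply: GF; rewrite /= inE.
  have -> : [set` Y :: Z :: s] = Y |` [set` Z :: s].
    by apply/seteqP; split=> T /=; rewrite inE => /predU1P.
  rewrite bigcup_setU1; apply: FU; first by apply: GF; exact: mem_head.
  apply: (IH Z) => [|T sT]; first exact: mem_head.
  by apply: GF; rewrite /= inE orbC; apply/orP; left.
split=> // G [X GX] GF.
(* Intersections reduce to unions by De Morgan. *)
rewrite -[X in F X]setCK setC_bigcap; apply: (FC).
rewrite -(bigcup_image G setC id); apply: Fcup; first by exists (~` X); exists X.
by move=> _ [Y GY <-]; apply/FC/GF.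
Qed.

(** Keeping [F] arbitrary lets the result serve [BAinf L] directly and [BA L] through a finite
    family. *)
Lemma syntactic_saturated_sub L F :
    complete_boolean_closed F -> DUO_preimage_closed F -> F L ->
  saturated (syntactic L) `<=` F.
Proof.
move=> FB FD FL X satX; have [_ FI FC] := complete_boolean_closedW FB.
have [Fcup Fcap _] := FB.
have [[r_refl _ _] _] := syntactic_congruence L.
have Fclass x : F [set y | syntactic L x y].
  pose G := [set Y | exists2 g, DUO g &
    Y = [set y | L (g x) <-> L (g y)]].
  have -> : [set y | syntactic L x y] = \bigcap_(Y in G) Y.
    apply/seteqP; split=> [y xy _ [g Dg ->]|y Gy g Dg]; first exact: xy.
    by apply: (Gy [set y | L (g x) <-> L (g y)]); exists g.
  apply: Fcap; first by exists [set y | L x <-> L y]; exists idfun => //; constructor.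
  move=> _ [g Dg ->]; have [Lx|nLx] := pselect (L (g x)).
    rewrite (_ : mkset _ = g @^-1` L); first exact: FD.
    by apply/seteqP; split=> y /=; tauto.
  rewrite (_ : mkset _ = ~` (g @^-1` L)); first exact/FC/FD.
  by apply/seteqP; split=> y /=; tauto.
(* Closure covers nonempty unions only, so the empty set is obtained separately. *)
have [[x0 Xx0]|X0] := pselect (X !=set0); last first.
  suff -> : X = L `&` ~` L by apply: FI => //; apply: FC.
  by rewrite setICr; apply/seteqP; split=> // x Xx; case: X0; exists x.
have -> : X = \bigcup_(C in (fun x => [set y | syntactic L x y]) @` X) C.
  rewrite bigcup_image; apply/seteqP; split=> [x Xx|y [x Xx xy]].
    by exists x => //; apply: r_refl.
  exact: satX xy Xx.
apply: Fcup; first by exists [set y | syntactic L x0 y]; exists x0.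
by move=> _ [x _ <-].
Qed.

Lemma saturated_preimage (f : A -> A) L :
  preserves f (syntactic L) -> saturated (syntactic L) (f @^-1` L).
Proof. by move=> fP x y /fP/(_ idfun (DUO_id A))[]. Qed.

Lemma BAinf_sub_saturated r L :
  congruence r -> saturated r L -> BAinf L `<=` saturated r.
Proof.
move=> rC satL; apply: smallest_sub; last by move=> _ ->.
split; last exact: saturated_DUO_preimage_closed.
by apply: saturated_complete_boolean_closed; case: rC.
Qed.

Lemma BA_sub_saturated r L :
  congruence r -> saturated r L -> BA L `<=` saturated r.
Proof.
move=> rC satL; apply: smallest_sub; last by move=> _ ->.
split; last exact: saturated_DUO_preimage_closed.
by apply/complete_boolean_closedW/saturated_complete_boolean_closed; case: rC.
Qed.

Lemma syntactic_saturated_BAinf L : saturated (syntactic L) `<=` BAinf L.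
Proof.
by move=> X satX F [[FB FD] FL]; apply: syntactic_saturated_sub satX => //; exact: FL.
Qed.

(** Intersecting a Boolean closed [F] with the finitely many [r]-saturated sets gives a finite
    family, which is therefore complete. *)
Lemma syntactic_saturated_BA r L :
    congruence r -> finite_index r -> saturated r L ->
  saturated (syntactic L) `<=` BA L.
Proof.
move=> rC rfin satL X satX F [[[FU FI FC] FD] FL].
have rE : Equivalence r by case: rC.
have [SU SI SC] :=
  complete_boolean_closedW (saturated_complete_boolean_closed rE).
suff [] : (F `&` saturated r) X by [].
apply: (syntactic_saturated_sub (L := L)) satX => //.
- apply: finite_complete_boolean_closed.
    exact: sub_finite_set (@subIsetr _ _ _) (finite_saturated rE rfin).
  split=> [Y Z [? ?] [? ?]|Y Z [? ?] [? ?]|Y [? ?]]; split.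
  + exact: FU. + exact: SU. + exact: FI. + exact: SI. + exact: FC. + exact: SC.
- move=> g Y Dg [FY SY]; split; first exact: FD.
  exact: saturated_DUO_preimage_closed.
- by split=> //; exact: FL.
Qed.

(** Each syntactic class is [r]-saturated, since [r] refines [syntactic L]. *)
Lemma syntactic_finite_index r L :
    congruence r -> finite_index r -> saturated r L ->
  finite_index (syntactic L).
Proof.
move=> rC rfin satL; have [rE _] := rC; have [_ r_sym _] := rE.
apply: sub_finite_set (finite_saturated rE rfin).
have [sE _] := syntactic_congruence L.
move=> _ [z _ <-] x y rxy; apply: saturated_class => // g Dg.
have rg := preserves_DUO rC Dg rxy.
by split; apply: satL => //; apply: r_sym.
Qed.

End Congruences.

(** * Quotient algebras and recognizability *)

Section Quotient.
Variables (S : signature) (A : algebra S) (r : A -> A -> Prop).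
Hypothesis rC : congruence r.

(** Classes are kept as subsets of [A], so [finite_index] directly bounds the carrier. *)
Definition quotient_carrier : Type :=
  {C : set A | range (fun x => [set y | r x y]) C}.

Definition quotient_proj (x : A) : quotient_carrier :=
  exist _ [set y | r x y] (imageT (fun x => [set y | r x y]) x).

Definition quotient_repr (C : quotient_carrier) : A := sval (cid2 (svalP C)).

Lemma quotient_reprK : cancel quotient_repr quotient_proj.
Proof.
by case=> D PD; apply: eq_exist; rewrite /quotient_repr /=; case: cid2.
Qed.

Lemma quotient_projP x y : quotient_proj x = quotient_proj y <-> r x y.
Proof.
have [[r_refl r_sym r_trans] _] := rC; split=> [/(congr1 sval) /= E|rxy].
  by have : [set z | r y z] y := r_refl y; rewrite -E.
apply: eq_exist; apply/seteqP; split=> z /=; apply: r_trans => //; exact: r_sym.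
Qed.

Definition quotient : algebra S :=
  @Algebra S quotient_carrier
    (fun xi x => quotient_proj (op (quotient_repr \o x)))
    (let: inhabits a := carrier_inhabited A in inhabits (quotient_proj a)).

Lemma quotient_proj_morphism : morphism (quotient_proj : A -> quotient).
Proof.
move=> xi x; apply/quotient_projP; have [_ r_op] := rC; apply: r_op => i.
by apply/quotient_projP; rewrite /= quotient_reprK.
Qed.

Lemma finite_quotient : finite_index r -> finite_set [set: quotient].
Proof.
move=> rfin; have sval_inj : injective (sval : quotient -> set A).
  by move=> [C PC] [D PD] /= CD; apply: eq_exist.
rewrite -(preimage_range (sval : quotient -> set A)).
apply: finite_preimage; first by move=> ? ? _ _; apply: sval_inj.
by apply: sub_finite_set rfin => _ [C _ <-]; exact: (svalP C).
Qed.

Lemma saturated_recognizable (L : set A) :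
  finite_index r -> saturated r L -> recognizable L.
Proof.
move=> rfin satL; exists quotient, quotient_proj; split.
- exact: finite_quotient.
- exact: quotient_proj_morphism.
- by apply/seteqP; split=> // C _; exists (quotient_repr C) => //; exact: quotient_reprK.
- apply/seteqP; split=> [|x [y Ly /quotient_projP ryx]]; first exact: preimage_image.
  exact: satL ryx Ly.
Qed.

End Quotient.

(** The kernel of [phi] works: its classes are indexed by values in the finite [M]. *)
Lemma recognizable_saturated (S : signature) (A : algebra S) (L : set A) :
  recognizable L ->
  exists r : A -> A -> Prop, [/\ congruence r, finite_index r & saturated r L].
Proof.
move=> [M [phi [Mfin phiM _ Lphi]]]; exists (fun x y => phi x = phi y); split.
- split; first by split=> [x|x y|x y z] // -> .
  by move=> xi x y /funext E; rewrite !phiM; congr op.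
- apply: sub_finite_set (finite_image (fun m => [set y | m = phi y]) Mfin).
  by move=> _ [x _ <-]; exists (phi x).
- by move=> x y E; rewrite Lphi /preimage /= E.
Qed.

Theorem theorem4p5 (S : signature) (A : algebra S) (f : A -> A) :
  (congruence_preserving f <-> (forall L : set A, BAinf L (f @^-1` L)))
  /\
  ((finite_index_congruence_preserving f <->
     (forall L : set A, recognizable L -> BA L (f @^-1` L)))
   /\
   (forall L : set A, recognizable L -> finite_set (BA L))).
Proof.
split; first split=> [fP L|fB r rC x y rxy].
- apply: syntactic_saturated_BAinf; apply: saturated_preimage.
  exact: fP (syntactic_congruence L).
- have [rE _] := rC; have [r_refl _ _] := rE.
  have satL : saturated r [set z | r (f x) z] by exact: saturated_class.
  exact: (BAinf_sub_saturated rC satL (fB _)) rxy (r_refl _).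
split; first split=> [fP L recL|fB r rC rfin x y rxy].
- have [r [rC rfin satL]] := recognizable_saturated recL.
  apply: (syntactic_saturated_BA rC rfin satL); apply: saturated_preimage.
  apply: fP; first exact: syntactic_congruence.
  exact: syntactic_finite_index rC rfin satL.
- have [rE _] := rC; have [r_refl _ _] := rE.
  have satL : saturated r [set z | r (f x) z] by exact: saturated_class.
  have recL := saturated_recognizable rC rfin satL.
  exact: (BA_sub_saturated rC satL (fB _ recL)) rxy (r_refl _).
move=> L /recognizable_saturated[r [rC rfin satL]]; have [rE _] := rC.
exact: sub_finite_set (BA_sub_saturated rC satL) (finite_saturated rE rfin).
Qed.
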